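(* Let $n$ be a positive even integer and $\mu>0$. Let $\mathbb{P}_n$ be the law on $\mathbb{R}^n$ of $X=\vartheta+Z$, where $\vartheta$ is uniformly distributed on the set of vectors in $\{\pm\mu\}^n$ with exactly $n/2$ entries equal to $-\mu$ and $n/2$ entries equal to $+\mu$, and $Z\sim\mathcal{N}(0,I_n)$ is independent of $\vartheta$. Let $\mathbb{Q}_n$ be the law of $X=\vartheta+Z$, where $\vartheta$ is uniformly distributed on $\{\pm\mu\}^n$ and $Z\sim\mathcal{N}(0,I_n)$ is independent of $\vartheta$. Then $$\chi^2(\mathbb{P}_n\|\mathbb{Q}_n)=\begin{cases}O(\mu^4)&\text{if }\mu\le1,\\ O(\exp(\mu^2))&\text{if }\mu>1,\end{cases}$$ where the constants hidden in $O(\cdot)$ are absolute (independent of $n$ and $\mu$).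
   Context: $\chi^2(P\|Q)=\int\frac{(\mathrm{d}P-\mathrm{d}Q)^2}{\mathrm{d}Q}$. *)

(* Defs.v *)
From HB Require Import structures.
From mathcomp Require Import all_boot all_order all_algebra.
From mathcomp Require Import all_classical all_reals all_analysis.
From mathcomp Require Import measurable_realfun.

Set Implicit Arguments.
Unset Strict Implicit.
Unset Printing Implicit Defensive.

Import Order.TTheory GRing.Theory Num.Theory.
Import numFieldNormedType.Exports.

Local Open Scope classical_set_scope.
Local Open Scope charge_scope.
Local Open Scope ring_scope.

Section general_laws.
Context d (T : measurableType d) (R : realType).

(* int (dP - dQ)^2 / dQ = int (dP/dQ - 1)^2 dQ when P << Q, and +oo otherwise *)
Definition chi2 (P Q : probability T R) : \bar R :=
  if `[< P `<< Q >] then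
    (\int[Q]_x ('d (charge_of_finite_measure P) '/d Q x - 1) ^+ 2)%E
  else +oo%E.

(* The normalized counting measure of S; the Dirac mass at [x0] is only used
   when S is empty or infinite. *)
Definition uniform_on (S : set T) (mS : measurable S) (x0 : T) :
    probability T R :=
  mnormalize (mrestr (@counting T R) mS) \d_x0.

End general_laws.
Arguments uniform_on {d T} R {S} mS x0.

(* R^n is [n.-tuple R] with its product sigma-algebra. *)
Section euclidean_laws.
Context (R : realType).

(* [measurableTypeR R] is R with the Borel sigma-algebra, in the form on which
   [normal_prob] is defined. *)
Definition vcons n (p : measurableTypeR R * n.-tuple R) : n.+1.-tuple R :=
  [tuple of (p.1 : R) :: p.2].

Lemma measurable_vcons n :
  measurable_fun [set: measurableTypeR R * n.-tuple R] (@vcons n).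
Proof.
exact: (@measurable_cons _ _ _ _ (fun p => p.1 : R) n snd
  measurable_fst measurable_snd).
Qed.

HB.instance Definition _ n :=
  isMeasurableFun.Build _ _ _ _ (@vcons n) (@measurable_vcons n).

Definition vadd n (p : n.-tuple R * n.-tuple R) : n.-tuple R :=
  [tuple tnth p.1 i + tnth p.2 i | i < n].

Lemma measurable_vadd n :
  measurable_fun [set: n.-tuple R * n.-tuple R] (@vadd n).
Proof.
apply/measurable_fun_tnthP => i.
rewrite (_ : _ \o _ = fun p => tnth p.1 i + tnth p.2 i); last first.
  by apply/funext => p /=; rewrite tnth_mktuple.
apply: measurable_funD.
  exact: (measurableT_comp (@measurable_tnth _ R n i) measurable_fst).
exact: (measurableT_comp (@measurable_tnth _ R n i) measurable_snd).
Qed.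

HB.instance Definition _ n :=
  isMeasurableFun.Build _ _ _ _ (@vadd n) (@measurable_vadd n).

(* N(0, I_n): the n-fold product of N(0, 1) *)
Fixpoint std_gaussian n : probability (n.-tuple R) R :=
  match n with
  | 0 => \d_([tuple] : 0.-tuple R)
  | m.+1 => distribution (normal_prob 0 1 \x std_gaussian m)%E (@vcons m)
  end.

(* law of theta + Z for independent theta ~ nu and Z ~ N(0, I_n) *)
Definition signal_plus_noise n (nu : probability (n.-tuple R) R) :
    probability (n.-tuple R) R :=
  distribution (nu \x std_gaussian n)%E (@vadd n).

Definition sign_cube n (mu : R) : set (n.-tuple R) :=
  [set x | forall i, tnth x i = - mu \/ tnth x i = mu].

Definition balanced_sign_cube n (mu : R) : set (n.-tuple R) :=
  [set x | [/\ sign_cube mu x,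
               #|[set i | tnth x i == - mu]%SET| = n./2 &
               #|[set i | tnth x i == mu]%SET| = n./2]].

Lemma measurable_tuple_set1 n (x : n.-tuple R) : measurable [set x].
Proof.
rewrite (_ : [set x] = \big[setI/setT]_(i < n)
    ((fun y : n.-tuple R => tnth y i) @^-1` [set tnth x i])).
  apply: bigsetI_measurable => i _; rewrite -[X in measurable X]setTI.
  by apply: measurable_tnth => //; exact: measurable_set1.
rewrite -bigcap_seq; apply/seteqP; split => [y -> i //|y xy].
by apply/eq_from_tnth => i; exact: (xy i (mem_index_enum i)).
Qed.

Lemma finite_sign_cube n (mu : R) : finite_set (@sign_cube n mu).
Proof.
pose f (b : {ffun 'I_n -> bool}) : n.-tuple R :=
  [tuple if b i then mu else - mu | i < n].
apply: (@sub_finite_set _ _ (f @` setT)); last exact/finite_image/finite_finset.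
move=> x xmu; exists [ffun i => tnth x i == mu] => //.
apply: eq_from_tnth => i; rewrite tnth_mktuple ffunE.
by case: eqVneq => [->//|]; case: (xmu i) => -> //; rewrite eqxx.
Qed.

Lemma measurable_sign_cube n (mu : R) : measurable (@sign_cube n mu).
Proof.
apply: countable_measurable; first exact: measurable_tuple_set1.
exact/finite_set_countable/finite_sign_cube.
Qed.

Lemma measurable_balanced_sign_cube n (mu : R) :
  measurable (@balanced_sign_cube n mu).
Proof.
apply: countable_measurable; first exact: measurable_tuple_set1.
apply/finite_set_countable/(sub_finite_set _ (@finite_sign_cube n mu)).
by move=> x [].
Qed.

Definition P_law n (mu : R) : probability (n.-tuple R) R :=
  signal_plus_noise
    (uniform_on R (@measurable_balanced_sign_cube n mu) [tuple 0 | _ < n]).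

Definition Q_law n (mu : R) : probability (n.-tuple R) R :=
  signal_plus_noise
    (uniform_on R (@measurable_sign_cube n mu) [tuple 0 | _ < n]).

End euclidean_laws.

(* Main.v *)
From HB Require Import structures.
Require Import Defs.
From mathcomp Require Import all_boot all_order all_algebra.
From mathcomp Require Import all_classical all_reals all_analysis.
From mathcomp Require Import measurable_realfun.
From mathcomp Require Import ring lra zify finmap.

(** Both laws are mixtures of translates of [G = N(0, I_n)], so they have
    densities [p] and [q] with respect to [G], and [chi^2 + 1 = int p^2/q dG].
    As [q] is a product, expanding [p^2] turns this integral into the average,
    over two independent balanced sign vectors [s] and [s'], of
    [prod_i (1 + t s_i s'_i)], where [t] is the mean of [tanh(mu X_i)^2] under Q.

    Expand that product over subsets [S] of the coordinates. The average of
    [prod_(i in S) s_i] depends only on [k = #|S|] and equals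
    [kappa_k / binom(n, k)], where [kappa_k], the [k]-th elementary symmetric
    function of a balanced sign vector, is the coefficient of [X^k] in
    [(1 - X^2)^(n/2)]. Hence the average is [sum_k t^k kappa_k^2 / binom(n, k)];
    since [kappa_1 = 0] and [kappa_k^2 <= binom(n, k)] (Vandermonde), we get
    [chi^2 <= sum_(k >= 2) t^k = t^2 / (1 - t)].

    Finally [exp(- mu^2) <= 1 - t] by Jensen's inequality, so that
    [t <= min(1, mu^2)] and [chi^2 <= t^2 exp(mu^2)]. *)

Set Implicit Arguments.
Unset Strict Implicit.
Unset Printing Implicit Defensive.

Import Order.TTheory GRing.Theory Num.Theory.
Import numFieldNormedType.Exports.

Local Open Scope classical_set_scope.
Local Open Scope charge_scope.
Local Open Scope ring_scope.

(** * Overlaps of balanced sign vectors *)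

Section char.
Variables (R : comNzRingType) (n : nat).
Implicit Types A S : {set 'I_n}.

Definition set_sign A (i : 'I_n) : R := (-1) ^+ (i \in A).

(** Both sides are (-1) to the power #|A :&: S|. This symmetry is what allows averaging over sign
    vectors for a fixed S to be read as a coefficient as well. *)
Lemma prod_set_signC A S :
  \prod_(i in S) set_sign A i = \prod_(i in A) set_sign S i.
Proof.
have h (X Y : {set _}) : \prod_(i in X) set_sign Y i = (-1) ^+ #|X :&: Y|.
  rewrite -sum1_card expr_sum [LHS]big_mkcond [RHS]big_mkcond /=.
  apply: eq_bigr => i _; rewrite /set_sign inE.
  by case: (i \in X); case: (i \in Y).
by rewrite !h finset.setIC.
Qed.

(** When the product is expanded, S collects the factors that contribute their X-term, so the
    coefficient is the k-th elementary symmetric function of x. *)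
Lemma coef_prod_1DX (x : 'I_n -> R) k :
  (\prod_i (1 + (x i)%:P * 'X))`_k = \sum_(S : {set 'I_n} | #|S| == k) \prod_(i in S) x i.
Proof.
under eq_bigr do rewrite addrC.
rewrite bigA_distr coef_sum [RHS]big_mkcond /=; apply: eq_bigr => S _.
rewrite -big_mkcond /= big_split /= prodr_const -rmorph_prod coefCM coefXn eq_sym.
by case: eqP; rewrite ?mulr1 ?mulr0.
Qed.

Lemma prod_set_sign_poly A :
  \prod_i (1 + (set_sign A i)%:P * 'X) =
  (1 - 'X) ^+ #|A| * (1 + 'X) ^+ (n - #|A|) :> {poly R}.
Proof.
have -> : (n - #|A| = #|~: A|)%N by rewrite [RHS]cardsCs finset.setCK card_ord.
rewrite (bigID (mem A)) /=.
congr (_ * _).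
  rewrite -prodr_const; apply: eq_bigr => i iA.
  by rewrite /set_sign iA expr1 polyCN mulN1r.
rewrite -[in RHS]prodr_const; apply: eq_big => [i|i /negbTE iA]; first by rewrite inE.
by rewrite /set_sign iA expr0 mul1r.
Qed.

Lemma sum_prod_set_sign A k :
  \sum_(S : {set 'I_n} | #|S| == k) \prod_(i in S) set_sign A i =
  ((1 - 'X) ^+ #|A| * (1 + 'X) ^+ (n - #|A|) : {poly R})`_k.
Proof. by rewrite -coef_prod_1DX prod_set_sign_poly. Qed.

End char.

Lemma coef_1BX2_exp (R : comNzRingType) m k :
  ((1 - 'X ^+ 2) ^+ m : {poly R})`_k =
  if odd k then 0 else (-1) ^+ k./2 *+ 'C(m, k./2).
Proof.
rewrite exprBn coef_sum.
have E (i : 'I_m.+1) : ((-1) ^+ i * 1 ^+ (m - i) * 'X^2 ^+ i *+ 'C(m, i) : {poly R})`_k =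
    if (k == i.*2) then (-1) ^+ i *+ 'C(m, i) else 0.
  rewrite expr1n mulr1 -exprM mul2n -(rmorphN1 polyC) -rmorphXn /= coefMn coefCM.
  by rewrite coefXn; case: eqP; rewrite ?mulr1 ?mulr0 ?mul0rn.
rewrite (eq_bigr _ (fun i _ => E i)).
case: (boolP (odd k)) => ok.
  rewrite big1 // => i _; case: eqP => // kE; by rewrite kE odd_double in ok.
have kE : k = (k./2).*2 by lia.
case: (ltnP k./2 m.+1) => km; last first.
  rewrite bin_small ?mulr0n// big1 // => i _; case: eqP => // kE'.
  have := ltn_ord i; lia.
rewrite (bigD1 (Ordinal km)) //= -kE eqxx big1 ?addr0 // => i /eqP ik.
case: eqP => // ki; exfalso; apply: ik; apply: val_inj => /=; lia.
Qed.

(** The square is the middle term of the Vandermonde convolution for the right-hand side. *)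
Lemma sqr_bin_le m j : ('C(m, j) ^ 2 <= 'C(m.*2, j.*2))%N.
Proof.
rewrite -addnn -binomial.Vandermonde.
have hj : (j < (j.*2).+1)%N by lia.
by rewrite (bigD1 (Ordinal hj)) //= (_ : j.*2 - j = j)%N ?mulnn ?leq_addr//; lia.
Qed.

(** * Averages over pairs of balanced sign vectors *)

Section overlap.
Variables (R : realFieldType) (m : nat).
Let n := m.*2.
Variable t : R.
Hypotheses (t0 : 0 <= t) (t1 : t < 1).

Let kappa k : R := ((1 - 'X ^+ 2) ^+ m : {poly R})`_k.

Let kappa_sqr_le k : kappa k ^+ 2 <= 'C(n, k)%:R.
Proof.
rewrite /kappa coef_1BX2_exp; case: ifPn => ok; first by rewrite expr0n /= ler0n.
rewrite -mulr_natl exprMn -exprM mulnC exprM sqrrN expr1n expr1n mulr1.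
rewrite -natrX ler_nat (leq_trans (sqr_bin_le _ _)) // -/n.
by rewrite (_ : k./2.*2 = k) //; lia.
Qed.

Let poly_balanced (A : {set 'I_n}) : #|A| == m ->
  (1 - 'X) ^+ #|A| * (1 + 'X) ^+ (n - #|A|) = (1 - 'X ^+ 2) ^+ m :> {poly R}.
Proof.
move=> /eqP ->; rewrite /n (_ : m.*2 - m = m)%N; last by lia.
by rewrite -exprMn; congr (_ ^+ _); ring.
Qed.

(** For any fixed S of size k, this is the sum of the products of signs over S, taken over all
    balanced sign vectors. *)
Let beta k : R := ((1 - 'X) ^+ k * (1 + 'X) ^+ (n - k) : {poly R})`_m.

(** Double counting over pairs (S, A) with #|S| = k and #|A| = m: the inner sum is [beta k] for
    fixed S and [kappa k] for fixed A. *)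
Let beta_kappa k : 'C(n, k)%:R * beta k = 'C(n, m)%:R * kappa k.
Proof.
transitivity (\sum_(S : {set 'I_n} | #|S| == k)
    \sum_(A : {set 'I_n} | #|A| == m) \prod_(i in S) set_sign R A i).
  rewrite (eq_bigr (fun=> beta k)) => [|S /eqP Sk].
    by rewrite sumr_const -cardsE card_draws card_ord mulr_natl.
  rewrite /beta -Sk -sum_prod_set_sign; apply: eq_bigr => A _.
  exact: prod_set_signC.
rewrite exchange_big /= (eq_bigr (fun=> kappa k)) => [|A AB].
  by rewrite sumr_const -cardsE card_draws card_ord mulr_natl.
by rewrite sum_prod_set_sign poly_balanced.
Qed.

Lemma sum_overlap_le :
  \sum_(A : {set 'I_n} | #|A| == m) \sum_(A' : {set 'I_n} | #|A'| == m)
    \prod_i (1 + t * (set_sign R A i * set_sign R A' i))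
   <= 'C(n, m)%:R ^+ 2 * (1 + t ^+ 2 / (1 - t)).
Proof.
pose chi (S A : {set 'I_n}) := \prod_(i in S) set_sign R A i.
have -> : \sum_(A : {set 'I_n} | #|A| == m) \sum_(A' : {set 'I_n} | #|A'| == m)
      \prod_i (1 + t * (set_sign R A i * set_sign R A' i)) =
    \sum_(S : {set 'I_n}) t ^+ #|S| * beta #|S| ^+ 2.
  (* S is the set of factors from which the term with t is taken. For fixed S the double sum over A
     and A' then splits into a square. *)
  transitivity (\sum_(A : {set 'I_n} | #|A| == m) \sum_(A' : {set 'I_n} | #|A'| == m)
      \sum_(S : {set 'I_n}) t ^+ #|S| * (chi S A * chi S A')).
    apply: eq_bigr => A _; apply: eq_bigr => A' _.
    under eq_bigr do rewrite addrC.
    rewrite bigA_distr; apply: eq_bigr => S _.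
    by rewrite -big_mkcond /= !big_split /= prodr_const.
  under eq_bigr do rewrite exchange_big.
  rewrite exchange_big /=; apply: eq_bigr => S _.
  under eq_bigr do rewrite -mulr_sumr -mulr_sumr.
  rewrite -mulr_sumr -mulr_suml; congr (_ * (_ * _)); rewrite /beta -sum_prod_set_sign;
    apply: eq_bigr => A _; exact: prod_set_signC.
(* Subsets are grouped by cardinality, which is at most n, so [inord] preserves it. *)
rewrite (partition_big (fun S : {set 'I_n} => inord #|S| : 'I_n.+1) predT) //=.
have Sn (S : {set 'I_n}) : (#|S| < n.+1)%N by rewrite ltnS -[leqRHS]card_ord max_card.
(* By [beta_kappa], the ['C(n, k)] subsets of size k together contribute [T k] times the square of
   ['C(n, m)]. *)
pose T k : R := t ^+ k * kappa k ^+ 2 / 'C(n, k)%:R.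
have -> : \sum_(j < n.+1) \sum_(S : {set 'I_n} | inord #|S| == j) t ^+ #|S| * beta #|S| ^+ 2 =
   'C(n, m)%:R ^+ 2 * \sum_(j < n.+1) T j.
  rewrite mulr_sumr; apply: eq_bigr => j _.
  rewrite (eq_big (fun S : {set 'I_n} => #|S| == j) (fun=> t ^+ j * beta j ^+ 2)); first last.
  - by move=> S /eqP <-; rewrite inordK.
  - by move=> S; rewrite -val_eqE /= inordK.
  rewrite sumr_const -cardsE card_draws card_ord -mulr_natl /T.
  have c0 : 'C(n, j)%:R != 0 :> R by rewrite pnatr_eq0 -lt0n bin_gt0 -ltnS.
  have -> : beta j = 'C(n, m)%:R * kappa j / 'C(n, j)%:R by rewrite -beta_kappa mulrC mulKf.
  by field.
apply: ler_wpM2l; first exact: sqr_ge0.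
have Tle k : (k <= n)%N -> T k <= t ^+ k.
  move=> kn; have c0 : 0 < 'C(n, k)%:R :> R by rewrite ltr0n bin_gt0.
  rewrite /T ler_pdivrMr //; apply: ler_wpM2l; [exact: exprn_ge0|exact: kappa_sqr_le].
have T1 : T 1 = 0 by rewrite /T /kappa coef_1BX2_exp /= expr0n /= mulr0 mul0r.
(* Geometric sum with its remainder kept, multiplied by 1 - t. Since [T 1 = 0], the powers of t
   start at 2, hence the exponent 2 rather than 1 when N = 0. *)
have H N : (N <= n)%N -> (1 - t) * \sum_(j < N.+1) T j + t ^+ (maxn N.+1 2) <= 1 - t + t ^+ 2.
  elim: N => [_|N IH Nn].
    rewrite big_ord1 /= lerD2r ler_piMr ?subr_ge0 ?(ltW t1)//.
    by have := Tle 0%N (leq0n _); rewrite expr0.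
  rewrite big_ord_recr /=; have := IH (ltnW Nn); case: N Nn {IH} => [|N] Nn.
    by rewrite T1 addr0 (_ : maxn 1 2 = 2%N)// (_ : maxn 2 2 = 2%N).
  rewrite (maxn_idPl _)// (maxn_idPl _)//.
  have := Tle _ Nn; set a := T _; set b := t ^+ N.+2.
  set s := \sum_(_ < _) _.
  move=> ab IH; rewrite exprS -/b (le_trans _ IH)// mulrDr -addrA lerD2l -lerBrDr.
  have -> : b - t * b = (1 - t) * b by rewrite mulrBl mul1r.
  by rewrite ler_wpM2l ?subr_ge0 ?(ltW t1).
have := H n (leqnn _); have : 0 <= t ^+ (maxn n.+1 2) by exact: exprn_ge0.
move=> tn0 Hn; rewrite -(ler_pM2l (_ : 0 < 1 - t)) ?subr_gt0//.
rewrite mulrDr mulr1 [_ * (_ / _)]mulrC divfK ?subr_eq0 ?(gt_eqF t1)//.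
by apply: le_trans Hn; rewrite lerDl.
Qed.

End overlap.

(** * Integrals against densities and Gaussian shifts *)

Lemma ge0_integral_sum_cond d (T : measurableType d) (R : realType)
    (mu : {measure set T -> \bar R}) (I : Type) (s : seq I) (P : pred I)
    (f : I -> T -> \bar R) :
  (forall i, measurable_fun setT (f i)) -> (forall i x, 0 <= f i x)%E ->
  (\int[mu]_x \sum_(i <- s | P i) f i x = \sum_(i <- s | P i) \int[mu]_x f i x)%E.
Proof.
move=> mf f0; rewrite -[RHS]big_filter -ge0_integral_sum//.
by apply: eq_integral => x _; rewrite big_filter.
Qed.

Lemma emeasurable_sum_cond d (T : measurableType d) (R : realType)
    (I : Type) (s : seq I) (P : pred I) (f : I -> T -> \bar R) :
  (forall i, measurable_fun setT (f i)) ->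
  measurable_fun setT (fun x => \sum_(i <- s | P i) f i x)%E.
Proof.
by move=> mf; under eq_fun do rewrite -big_filter; exact: emeasurable_sum.
Qed.

(** Change of variables holds for the Radon-Nikodym derivative of nu, which agrees with g almost
    everywhere because both have the same integral over every measurable set. *)
Lemma ge0_integral_density d (T : measurableType d) (R : realType)
    (mu : {sigma_finite_measure set T -> \bar R})
    (nu : {finite_measure set T -> \bar R}) (g : T -> \bar R) :
  measurable_fun setT g -> (forall x, 0 <= g x)%E ->
  (forall A, measurable A -> nu A = \int[mu]_(x in A) g x)%E ->
  forall f : T -> \bar R, measurable_fun setT f -> (forall x, 0 <= f x)%E ->
  (\int[nu]_x f x = \int[mu]_x (f x * g x))%E.
Proof.
move=> mg g0 nug f mf f0.
have numu : nu `<< mu.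
  apply/null_content_dominatesP => A mA muA; rewrite nug//.
  by apply: null_set_integral => //; exact: measurable_funTS.
have gi : mu.-integrable setT g.
  apply/integrableP; split=> //.
  under eq_integral do rewrite gee0_abs//.
  by rewrite -nug// -ge0_fin_numE// fin_num_measure.
rewrite -(Radon_Nikodym_SigmaFinite.change_of_variables numu)//.
have mrn : measurable_fun setT (Radon_Nikodym_SigmaFinite.f nu mu).
  exact: measurable_int (Radon_Nikodym_SigmaFinite.f_integrable numu).
apply: ge0_ae_eq_integral => //.
- exact: emeasurable_funM.
- exact: emeasurable_funM.
- by move=> x _; rewrite mule_ge0// Radon_Nikodym_SigmaFinite.f_ge0.
- by move=> x _; rewrite mule_ge0.
apply: ae_eqe_mul2l.
apply: ae_eq_sym; apply: integral_ae_eq => // A _ mA.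
by rewrite -nug// -Radon_Nikodym_SigmaFinite.f_integral.
Qed.

(** * Translations of Lebesgue measure and of N(0, 1) *)

Section normal.
Variable R : realType.
Local Notation leb := (@lebesgue_measure R).
Local Notation N01 := (normal_prob (0 : R) 1).

(** Lebesgue measure is determined by its values on half-open intervals, and a translation preserves
    their length. *)
Lemma lebesgue_measure_addl (a : R) (A : set R) : measurable A ->
  pushforward leb ((fun x : R => a + x) : _ -> measurableTypeR R) A = leb A.
Proof.
move=> mA; apply/esym/lebesgue_measure_unique => //=.
  exact: measurable_funD.
move=> _ _ [[b c]] _ <-.
rewrite /pushforward.
rewrite (_ : _ @^-1` _ = `]b - a, c - a]%classic).
  rewrite !lebesgue_measure_itv/= !lte_fin ltrD2r.
  by case: ifPn => // _; rewrite -!EFinB; congr (_%:E); ring.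
by apply/seteqP; split => x /=; rewrite !in_itv/= ltrBlDl lerBrDl.
Qed.

Lemma ge0_integral_lebesgue_addl (a : R) (f : R -> \bar R) :
  measurable_fun setT f -> (forall x, 0 <= f x)%E ->
  (\int[leb]_x f (a + x)%R = \int[leb]_x f x)%E.
Proof.
move=> mf f0.
have ma : measurable_fun setT ((fun x : R => a + x) : R -> measurableTypeR R).
  exact: measurable_funD.
transitivity (\int[pushforward leb ((fun x : R => (a + x)%R) : _ -> measurableTypeR R)]_x f x)%E.
  by rewrite ge0_integral_pushforward.
apply: eq_measure_integral => A mA _; exact: lebesgue_measure_addl.
Qed.

Lemma ge0_integral_normal_prob (f : R -> \bar R) :
  measurable_fun setT f -> (forall x, 0 <= f x)%E ->
  (\int[N01]_x f x = \int[leb]_x (f x * (normal_pdf 0 1 x)%:E))%E.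
Proof.
move=> mf f0.
have mpdf : measurable_fun [set: R] (EFin \o normal_pdf 0 1).
  by apply/measurable_EFinP; exact: measurable_normal_pdf.
apply: (@ge0_integral_density _ (measurableTypeR R) R leb (normal_prob 0 1)
  (EFin \o normal_pdf 0 1)) => //= x.
by rewrite lee_fin normal_pdf_ge0.
Qed.

(* density of N(a, 1) with respect to N(0, 1) *)
Definition tilt (a x : R) : R := expR (a * x - a ^+ 2 / 2).

Lemma tilt_gt0 a x : 0 < tilt a x. Proof. exact: expR_gt0. Qed.

Lemma measurable_tilt a : measurable_fun setT (tilt a).
Proof.
by apply: measurableT_comp => //; exact: measurable_funB.
Qed.

(** Completing the square in the exponent. *)
Lemma normal_pdf_tilt a x : tilt a x * normal_pdf 0 1 x = normal_pdf 0 1 (x - a).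
Proof.
rewrite !normal_pdfE ?oner_eq0// /tilt mulrCA /normal_fun -expRD.
by congr (_ * expR _); field.
Qed.

(** Cameron-Martin formula in dimension one: written against Lebesgue measure, the translation moves
    onto the normal density, where it becomes the factor [tilt a]. *)
Lemma ge0_integral_normal_addl a (f : R -> \bar R) :
  measurable_fun setT f -> (forall x, 0 <= f x)%E ->
  (\int[N01]_x f (a + x)%R = \int[N01]_x (f x * (tilt a x)%:E))%E.
Proof.
move=> mf f0.
have mt := measurable_tilt a.
rewrite !ge0_integral_normal_prob//; first last.
- by apply: measurableT_comp => //; exact: measurable_funD.
- by move=> x; rewrite mule_ge0// lee_fin ltW// tilt_gt0.
- by apply: emeasurable_funM => //; exact/measurable_EFinP.
pose h x := (f x * (normal_pdf 0 1 (x - a))%:E)%E.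
transitivity (\int[leb]_x h (a + x)%R)%E.
  by apply: eq_integral => x _; rewrite /h addrAC subrr add0r.
rewrite ge0_integral_lebesgue_addl.
- by apply: eq_integral => x _; rewrite /h -normal_pdf_tilt EFinM muleA.
- apply: emeasurable_funM => //; apply/measurable_EFinP.
  apply: measurableT_comp; first exact: measurable_normal_pdf.
  exact: measurable_funB.
- by move=> x; rewrite mule_ge0// lee_fin normal_pdf_ge0.
Qed.

Lemma integral_tilt a : (\int[N01]_x (tilt a x)%:E = 1)%E.
Proof.
transitivity (\int[N01]_x cst 1%E (a + x)%R)%E; last first.
  rewrite [LHS](integral_cst (normal_prob 0 1) measurableT 1%E).
  by rewrite mul1e; exact: (@probability_setT _ _ _ (normal_prob 0 1)).
rewrite (@ge0_integral_normal_addl a (cst 1%E))//.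
by apply: eq_integral => x _; rewrite mul1e.
Qed.

End normal.

(** * Translations and product integrands under N(0, I_n) *)

Section tuple.
Variable R : realType.
Local Notation N01 := (normal_prob (0 : R) 1).

Lemma ge0_integral_std_gaussianS n (f : n.+1.-tuple R -> \bar R) :
  measurable_fun setT f -> (forall x, 0 <= f x)%E ->
  (\int[std_gaussian R n.+1]_x f x =
   \int[N01]_x \int[std_gaussian R n]_y f [tuple of x :: y])%E.
Proof.
move=> mf f0; rewrite /std_gaussian -/std_gaussian.
rewrite ge0_integral_distribution// fubini_tonelli1//.
  by apply: measurableT_comp => //; exact: measurable_vcons.
by move=> p; exact: f0.
Qed.

Lemma ge0_integral_std_gaussian0 (f : 0.-tuple R -> \bar R) :
  measurable_fun setT f -> (\int[std_gaussian R 0]_x f x = f [tuple])%E.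
Proof. by move=> mf; rewrite /= integral_dirac// diracT mul1e. Qed.

Lemma measurable_prod_tnth n (h : 'I_n -> R -> R) :
  (forall i, measurable_fun setT (h i)) ->
  measurable_fun setT (fun x : n.-tuple R => \prod_i h i (tnth x i)).
Proof.
move=> mh; apply: measurable_prod => i _.
exact: (measurableT_comp (mh i) (@measurable_tnth _ R n i)).
Qed.

(** The density of N(a, I_n) with respect to N(0, I_n). *)
Definition tilts n (a x : n.-tuple R) : R := \prod_i tilt (tnth a i) (tnth x i).

Lemma tilts_gt0 n (a x : n.-tuple R) : 0 < tilts a x.
Proof. by apply: prodr_gt0 => i _; exact: tilt_gt0. Qed.

Lemma measurable_tilts n (a : n.-tuple R) : measurable_fun setT (tilts a).
Proof.
apply: (@measurable_prod_tnth n (fun i => tilt (tnth a i))) => i.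
exact: measurable_tilt.
Qed.

Lemma measurable_vaddl n (a : n.-tuple R) :
  measurable_fun setT (fun z => vadd (a, z)).
Proof. by exact: (measurableT_comp (@measurable_vadd R n) (pair1_measurable a)). Qed.

(** Cameron-Martin formula in dimension n, by induction: Tonelli separates the first coordinate,
    which is shifted by the one-dimensional formula. *)
Lemma ge0_integral_std_gaussian_vadd n (a : n.-tuple R) (f : n.-tuple R -> \bar R) :
  measurable_fun setT f -> (forall x, 0 <= f x)%E ->
  (\int[std_gaussian R n]_z f (vadd (a, z)) =
   \int[std_gaussian R n]_x (f x * (tilts a x)%:E))%E.
Proof.
elim: n a f => [|n IH] a f mf f0.
  have ma := measurable_vaddl a; have mt := measurable_tilts a.
  rewrite !ge0_integral_std_gaussian0.
  - by rewrite /tilts big_ord0 mule1; congr f; apply/val_inj; case: (vadd _) => -[].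
  - by apply: emeasurable_funM => //; exact/measurable_EFinP.
  - exact: measurableT_comp.
have ma := measurable_vaddl a; have mt := measurable_tilts a.
have mcons x : measurable_fun setT (fun y : n.-tuple R => [tuple of x :: y]).
  by apply: measurable_cons.
rewrite !ge0_integral_std_gaussianS//; first last.
- exact: measurableT_comp.
- by move=> x; rewrite mule_ge0// lee_fin ltW// tilts_gt0.
- by apply: emeasurable_funM => //; exact/measurable_EFinP.
pose b : n.-tuple R := [tuple of behead a].
have bE j : tnth b j = tnth a (lift ord0 j).
  by rewrite tnth_behead; congr tnth; apply: val_inj; rewrite /= inordK// ltnS.
have vaddE x (y : n.-tuple R) : vadd (a, [tuple of x :: y]) = [tuple of thead a + x :: vadd (b, y)].
  apply: eq_from_tnth => i; rewrite tnth_mktuple /=.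
  case: (unliftP ord0 i) => [j|] ->. 2: by rewrite /thead !tnth0.
  by rewrite !tnthS tnth_mktuple /= bE.
have tiltsE x (y : n.-tuple R) : tilts a [tuple of x :: y] = tilt (thead a) x * tilts b y.
  rewrite /tilts big_ord_recl /= tnth0; congr (_ * _).
  by apply: eq_bigr => i _; rewrite tnthS bE.
(* The inner integral after the induction hypothesis has removed the shift by b; only the shift of
   the first coordinate remains. *)
pose F x := (\int[std_gaussian R n]_y (f [tuple of x :: y] * (tilts b y)%:E))%E.
transitivity (\int[N01]_x F (thead a + x)%R)%E.
  apply: eq_integral => x _; rewrite /F -IH//; last exact: measurableT_comp.
  by apply: eq_integral => y _; rewrite vaddE.
have mtb := measurable_tilts b.
have F0 x : (0 <= F x)%E.
  by apply: integral_ge0 => y _; rewrite mule_ge0// lee_fin ltW// tilts_gt0.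
rewrite ge0_integral_normal_addl//; last first.
  apply: (@measurable_fun_fubini_tonelli_F _ _ (measurableTypeR R) _ R (std_gaussian R n)
    (fun p : measurableTypeR R * n.-tuple R => f (vcons p) * (tilts b p.2)%:E)%E).
    apply: emeasurable_funM; first by apply: measurableT_comp => //; exact: measurable_vcons.
    by apply/measurable_EFinP; exact: measurableT_comp.
  by move=> p; rewrite mule_ge0// lee_fin ltW// tilts_gt0.
apply: eq_integral => x _; rewrite -ge0_integralZr//.
- by apply: eq_integral => y _; rewrite tiltsE [tilt _ _ * _]mulrC EFinM muleA.
- by apply: emeasurable_funM; [exact: measurableT_comp|exact/measurable_EFinP].
- by move=> y _; rewrite mule_ge0// lee_fin ltW// tilts_gt0.
- by rewrite lee_fin ltW// tilt_gt0.
Qed.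

Lemma ge0_integral_std_gaussian_prod n (h : 'I_n -> R -> R) :
  (forall i, measurable_fun setT (h i)) -> (forall i x, 0 <= h i x) ->
  (\int[std_gaussian R n]_x (\prod_i h i (tnth x i))%:E =
   \prod_i \int[N01]_x (h i x)%:E)%E.
Proof.
elim: n h => [|n IH] h mh h0.
  rewrite ge0_integral_std_gaussian0 ?big_ord0//.
  by apply/measurable_EFinP; exact: (measurable_prod_tnth mh).
rewrite ge0_integral_std_gaussianS//; first last.
- by move=> x; rewrite lee_fin prodr_ge0.
- by apply/measurable_EFinP; exact: (measurable_prod_tnth mh).
rewrite big_ord_recl -IH//.
have mp : measurable_fun setT (fun y : n.-tuple R => \prod_i h (lift ord0 i) (tnth y i)).
  exact: (@measurable_prod_tnth n (fun i => h (lift ord0 i))).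
rewrite -ge0_integralZr//; first last.
- by apply: integral_ge0 => y _; rewrite lee_fin prodr_ge0.
- by move=> x _; rewrite lee_fin.
- by apply/measurable_EFinP; exact: mh.
apply: eq_integral => x _; rewrite -ge0_integralZl//; first last.
- by rewrite lee_fin.
- by move=> y _; rewrite lee_fin prodr_ge0.
- exact/measurable_EFinP.
apply: eq_integral => y _; rewrite big_ord_recl tnth0 EFinM; congr (_ * (_)%:E)%E.
by apply: eq_bigr => i _; rewrite tnthS.
Qed.

End tuple.

(** * The divergence of two mixtures *)

Lemma measurable_fun_inv d (T : measurableType d) (R : realType) (q : T -> R) :
  measurable_fun setT q -> (forall x, 0 < q x) ->
  measurable_fun setT (fun x => (q x)^-1).
Proof.
move=> mq q0; rewrite (_ : (fun x => _) = (@powR R ^~ (-1)) \o q).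
  by apply: measurableT_comp => //; exact: measurable_powR.
by apply/funext => x /=; rewrite powR_inv1// ltW.
Qed.

Lemma counting_setI_seq (T : choiceType) (R : realType) (s : seq T) (X : set T) :
  uniq s -> counting (X `&` [set` s]) = (count (fun x => x \in X) s)%:R%:E :> \bar R.
Proof.
move=> us; have fin : finite_set (X `&` [set` s]).
  by apply: (sub_finite_set (@subIsetr _ _ _)); exact: finite_seq.
rewrite /counting asboolT//; congr (_%:R%:E).
have -> : fset_set (X `&` [set` s]) = [fset x in [seq x <- s | x \in X]]%fset.
  apply/fsetP => x; rewrite in_fset_set// !inE mem_filter.
  by apply/idP/idP => [/set_mem[/mem_set -> /=]//|/andP[/set_mem xX xs]]; exact/mem_set.
by rewrite card_fseq undup_id ?filter_uniq// size_filter.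
Qed.

(** The uniform law is identified with a scaled finite sum of Dirac masses at the entries of s,
    against which integration is evaluation. *)
Lemma ge0_integral_uniform_on d (T : measurableType d) (R : realType)
    (S : set T) (mS : measurable S) (x0 : T) (s : seq T) (f : T -> \bar R) :
  uniq s -> (0 < size s)%N -> S = [set` s] ->
  measurable_fun setT f -> (forall x, 0 <= f x)%E ->
  (\int[uniform_on R mS x0]_x f x = (size s)%:R^-1%:E * \sum_(x <- s) f x)%E.
Proof.
move=> us s0 SE mf f0.
have c0 : 0 <= (size s)%:R^-1 :> R by rewrite invr_ge0.
pose m := mscale (NngNum c0) (msum (fun k => \d_(nth x0 s k)) (size s)).
have muE A : measurable A -> uniform_on R mS x0 A = m A.
  subst S; move=> mA; rewrite /uniform_on /= /mnormalize /= /mrestr setTI.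
  have -> : counting [set` s] = (size s)%:R%:E :> \bar R.
    rewrite -[X in counting X]setTI counting_setI_seq// -count_predT.
    by congr (_%:R%:E); apply: eq_count => x; rewrite in_setT.
  (* The total mass is finite and nonzero, so [mnormalize] does not fall back on its default Dirac
     mass. *)
  rewrite eqe pnatr_eq0 (gtn_eqF s0) /= counting_setI_seq// muleC.
  rewrite /m /mscale /= /msum; congr (_ * _)%E.
  rewrite -sum1_count natr_sum big_mkcond /= -sumEFin (big_nth x0) big_mkord.
  by apply: eq_bigr => k _; rewrite /dirac indicE; case: (_ \in _).
rewrite (eq_measure_integral m); last by move=> A mA _; exact: muE.
rewrite ge0_integral_mscale// ge0_integral_measure_sum//; congr (_ * _)%E.
rewrite [RHS](big_nth x0) big_mkord; apply: eq_bigr => k _.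
by rewrite integral_dirac// diracT mul1e.
Qed.

(** * The divergence in terms of densities with respect to a common law *)

Section chi2_density.
Context d (T : measurableType d) (R : realType).
Variables (P Q G : probability T R) (p q : T -> R).
Hypotheses (mp : measurable_fun setT p) (mq : measurable_fun setT q).
Hypotheses (p0 : forall x, 0 <= p x) (q0 : forall x, 0 < q x).
Hypothesis PE : forall f : T -> \bar R, measurable_fun setT f ->
  (forall x, 0 <= f x)%E -> (\int[P]_x f x = \int[G]_x (f x * (p x)%:E))%E.
Hypothesis QE : forall f : T -> \bar R, measurable_fun setT f ->
  (forall x, 0 <= f x)%E -> (\int[Q]_x f x = \int[G]_x (f x * (q x)%:E))%E.

Let L x := p x / q x.
Let L0 x : 0 <= L x. Proof. by rewrite divr_ge0// ltW. Qed.
Let mL : measurable_fun setT L.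
Proof.
by apply: measurable_funM => //; exact: measurable_fun_inv.
Qed.

Let PL A : measurable A -> (P A = \int[Q]_(x in A) (L x)%:E)%E.
Proof.
move=> mA.
transitivity (\int[P]_x (\1_A x)%:E)%E; first by rewrite integral_indic// setIT.
rewrite PE//; last by apply/measurable_EFinP; exact: measurable_indic.
rewrite [RHS]integral_mkcond epatch_indic QE.
- apply: eq_integral => x _ /=; rewrite /L -!EFinM; congr EFin.
  by rewrite mulrAC divfK ?gt_eqF// mulrC.
- by apply: emeasurable_funM; apply/measurable_EFinP => //; exact: measurable_indic.
- by move=> x; rewrite mule_ge0// lee_fin.
Qed.

Let PQ : P `<< Q.
Proof.
apply/null_content_dominatesP => A mA QA; rewrite PL//.
by apply: null_set_integral => //; apply/measurable_funTS/measurable_EFinP.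
Qed.

(** With L = p / q, this is (L - 1)^2 + 2 L = L^2 + 1 integrated against Q. Keeping only nonnegative
    terms on each side avoids subtracting integrals that may be infinite. *)
Lemma chi2_densityE :
  (chi2 P Q + 2%:E = \int[G]_x (p x ^+ 2 / q x)%:E + 1)%E.
Proof.
have iL : Q.-integrable setT (EFin \o L).
  apply/integrableP; split; first exact/measurable_EFinP.
  under eq_integral do rewrite gee0_abs ?lee_fin//.
  by rewrite -PL// probability_setT ltry.
(* The derivative in [chi2] is only determined almost everywhere; by uniqueness it may be replaced
   by L. *)
have RNL : ae_eq Q setT ('d (charge_of_finite_measure P) '/d Q) (EFin \o L).
  apply: integral_ae_eq => //.
  - exact: Radon_Nikodym_integrable.
  - exact/measurable_EFinP.
  - by move=> A _ mA; rewrite -Radon_Nikodym_integral// -PL.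
rewrite /chi2 asboolT//.
have mRN : measurable_fun setT ('d (charge_of_finite_measure P) '/d Q).
  by apply: measurable_int; exact: Radon_Nikodym_integrable.
have -> : (\int[Q]_x ('d (charge_of_finite_measure P) '/d Q x - 1) ^+ 2 =
    \int[Q]_x ((L x - 1) ^+ 2)%:E)%E.
  apply: ge0_ae_eq_integral => //.
  - by under eq_fun do rewrite expe2; apply: emeasurable_funM; exact: emeasurable_funB.
  - by apply/measurable_EFinP; apply: measurable_funX; exact: measurable_funB.
  - by move=> x _; rewrite sqre_ge0.
  - by move=> x _; rewrite lee_fin sqr_ge0.
  - by apply: filterS RNL => x /= /[apply] ->.
(* L has mean 1 under Q because P has total mass 1. *)
have -> : (2%:E = \int[Q]_x (2 * L x)%:E)%E.
  under eq_integral do rewrite EFinM.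
  rewrite ge0_integralZl ?lee_fin//; first by rewrite -PL// probability_setT mule1.
    exact/measurable_EFinP.
  by move=> x _; rewrite lee_fin.
rewrite -ge0_integralD//; first last.
- by apply/measurable_EFinP; exact: measurable_funM.
- by move=> x _; rewrite lee_fin mulr_ge0.
- by apply/measurable_EFinP; apply: measurable_funX; exact: measurable_funB.
- by move=> x _; rewrite lee_fin sqr_ge0.
have -> : (1 = \int[Q]_x (cst 1 x))%E.
  by rewrite (integral_cst Q measurableT) mul1e; exact/esym/probability_setT.
have -> : (\int[G]_x (p x ^+ 2 / q x)%:E = \int[Q]_x (L x ^+ 2)%:E)%E.
  rewrite QE.
  - apply: eq_integral => x _; rewrite -EFinM /L; congr EFin.
    by field; rewrite gt_eqF.
  - by apply/measurable_EFinP; exact: measurable_funX.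
  - by move=> x; rewrite lee_fin sqr_ge0.
rewrite -ge0_integralD//; first last.
- by apply/measurable_EFinP; exact: measurable_funX.
- by move=> x _; rewrite lee_fin sqr_ge0.
apply: eq_integral => x _; rewrite -!EFinD; congr EFin; ring.
Qed.

End chi2_density.

(** * Uniform mixtures of Gaussian translates *)

Section mixture.
Variables (R : realType) (n : nat).
Implicit Types (s : seq (n.-tuple R)) (f : n.-tuple R -> \bar R).
Local Notation G := (std_gaussian R n).

Definition mixture s (x : n.-tuple R) : R := (size s)%:R^-1 * \sum_(a <- s) tilts a x.

Lemma measurable_mixture s : measurable_fun setT (mixture s).
Proof.
apply: measurable_funM => //; apply: measurable_sum => a; exact: measurable_tilts.
Qed.

Lemma mixture_ge0 s x : 0 <= mixture s x.
Proof.
by rewrite mulr_ge0 ?invr_ge0// sumr_ge0// => a _; rewrite ltW// tilts_gt0.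
Qed.

Lemma mixture_gt0 s x : (0 < size s)%N -> 0 < mixture s x.
Proof.
case: s => // a s _; rewrite mulr_gt0 ?invr_gt0 ?ltr0n// big_cons.
by rewrite ltr_wpDr ?tilts_gt0// sumr_ge0// => b _; rewrite ltW// tilts_gt0.
Qed.

(** [mixture s] is the density of the law with respect to N(0, I_n): for each signal, the integral
    over the noise is given by the shift formula, and the finite average is then moved inside. *)
Lemma ge0_integral_signal_plus_noise (S : set (n.-tuple R)) (mS : measurable S) x0 s f :
  uniq s -> (0 < size s)%N -> S = [set` s] ->
  measurable_fun setT f -> (forall x, 0 <= f x)%E ->
  (\int[signal_plus_noise (uniform_on R mS x0)]_x f x =
   \int[G]_x (f x * (mixture s x)%:E))%E.
Proof.
move=> us s0 SE mf f0.
have mfv : measurable_fun setT (f \o (@vadd R n)).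
  by apply: measurableT_comp => //; exact: measurable_vadd.
have ft0 a x : (0 <= f x * (tilts a x)%:E)%E.
  by rewrite mule_ge0// lee_fin ltW// tilts_gt0.
have mft a : measurable_fun setT (fun x => f x * (tilts a x)%:E)%E.
  by apply: emeasurable_funM => //; apply/measurable_EFinP; exact: measurable_tilts.
rewrite ge0_integral_distribution// fubini_tonelli1//; last by move=> p; exact: f0.
rewrite (ge0_integral_uniform_on mS x0 us s0 SE); first last.
- by move=> a; apply: integral_ge0 => z _; exact: f0.
- apply: (@measurable_fun_fubini_tonelli_F _ _ _ _ R G (f \o (@vadd R n))) => //.
  by move=> p; exact: f0.
under eq_bigr do rewrite [fubini_F _ _ _]ge0_integral_std_gaussian_vadd//.
rewrite -ge0_integral_sum// -ge0_integralZl//; first last.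
- by move=> x _; rewrite sume_ge0.
- exact: emeasurable_sum.
apply: eq_integral => x _; rewrite /mixture EFinM muleCA; congr (_ * _)%E.
rewrite -sumEFin ge0_sume_distrr// => a _.
by rewrite lee_fin ltW// tilts_gt0.
Qed.

End mixture.

(** * Enumeration of the two supports *)

Section signs.
Variables (R : realType) (n : nat) (mu : R).
Hypothesis mu0 : 0 < mu.

(** Vectors are indexed by the set of their negative entries. As mu > 0, this set can be read off
    the vector, so the enumerations below have no repetition. *)
Definition signs (A : {set 'I_n}) : n.-tuple R :=
  [tuple if i \in A then - mu else mu | i < n].

Let muN : (mu == - mu) = false.
Proof. by rewrite gt_eqF// (lt_trans _ mu0)// oppr_lt0. Qed.

Lemma signs_neg A : [set i | tnth (signs A) i == - mu]%SET = A.
Proof.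
by apply/setP => i; rewrite inE tnth_mktuple; case: ifP; rewrite ?eqxx ?muN.
Qed.

Lemma signs_pos A : [set i | tnth (signs A) i == mu]%SET = ~: A.
Proof.
apply/setP => i; rewrite !inE tnth_mktuple; case: ifP; rewrite ?eqxx//.
by rewrite eq_sym muN.
Qed.

Lemma signs_inj : injective signs.
Proof. by move=> A B AB; rewrite -(signs_neg A) AB signs_neg. Qed.

Lemma signsK x : sign_cube mu x -> signs [set i | tnth x i == - mu]%SET = x.
Proof.
move=> xmu; apply: eq_from_tnth => i; rewrite tnth_mktuple inE.
by case: (xmu i) => ->; rewrite ?eqxx ?muN.
Qed.

Lemma signs_cube A : sign_cube mu (signs A).
Proof. by move=> i; rewrite tnth_mktuple; case: ifP; [left|right]. Qed.

Definition cube_seq : seq (n.-tuple R) := [seq signs A | A : {set 'I_n}].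
Definition balanced_seq : seq (n.-tuple R) :=
  [seq signs A | A : {set 'I_n} <- enum {: {set 'I_n}} & #|A| == n./2].

Lemma cube_seqE : sign_cube mu = [set` cube_seq].
Proof.
apply/seteqP; split => x /=.
  by move=> xmu; apply/mapP; exists [set i | tnth x i == - mu]%SET; rewrite ?mem_enum ?signsK.
by move=> /mapP[A _ ->]; exact: signs_cube.
Qed.

Lemma balanced_seqE : ~~ odd n -> balanced_sign_cube mu = [set` balanced_seq].
Proof.
move=> n2; apply/seteqP; split => x /=.
  move=> [xmu xN _]; apply/mapP; exists [set i | tnth x i == - mu]%SET; rewrite ?signsK//.
  by rewrite mem_filter xN eqxx mem_enum.
move=> /mapP[A]; rewrite mem_filter => /andP[/eqP An _] ->; split.
- exact: signs_cube.
- by rewrite signs_neg.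
(* As n is even, the complement of a set of size n/2 also has size n/2. *)
- by rewrite signs_pos cardsCs finset.setCK card_ord An; lia.
Qed.

Lemma uniq_cube_seq : uniq cube_seq.
Proof. by rewrite (map_inj_uniq signs_inj) enum_uniq. Qed.

Lemma uniq_balanced_seq : uniq balanced_seq.
Proof. by rewrite (map_inj_uniq signs_inj) filter_uniq ?enum_uniq. Qed.

End signs.

(** * Overlap integrals of a single coordinate *)

Section overlap_integral.
Variables (R : realType) (mu : R).
Local Notation N01 := (normal_prob (0 : R) 1).

(** The density with respect to N(0, 1) of one coordinate under Q. *)
Definition tilt_avg (x : R) : R := (tilt mu x + tilt (- mu) x) / 2.

Lemma tilt_avg_gt0 x : 0 < tilt_avg x.
Proof. by rewrite divr_gt0// addr_gt0// tilt_gt0. Qed.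

Lemma measurable_tilt_avg : measurable_fun setT tilt_avg.
Proof.
apply: measurable_funM => //.
by apply: measurable_funD; exact: measurable_tilt.
Qed.

Definition tilt_ratio (a b x : R) : R := tilt a x * tilt b x / tilt_avg x.

Lemma tilt_ratio_ge0 a b x : 0 <= tilt_ratio a b x.
Proof. by rewrite ltW// !mulr_gt0 ?invr_gt0 ?tilt_gt0 ?tilt_avg_gt0. Qed.

Lemma measurable_tilt_ratio a b : measurable_fun setT (tilt_ratio a b).
Proof.
apply: measurable_funM.
  by apply: measurable_funM; exact: measurable_tilt.
exact: (measurable_fun_inv measurable_tilt_avg tilt_avg_gt0).
Qed.

Lemma integral_tilt_avg : (\int[N01]_x (tilt_avg x)%:E = 1)%E.
Proof.
have mt a := @measurable_tilt R a.
have t0 a (x : R) : 0 <= tilt a x by rewrite ltW// tilt_gt0.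
under eq_integral do rewrite /tilt_avg EFinM EFinD.
rewrite ge0_integralZr//; first last.
- by move=> x _; rewrite -EFinD lee_fin addr_ge0 ?t0.
- by apply: emeasurable_funD; (apply/measurable_EFinP; exact: mt).
rewrite ge0_integralD//; first last.
- by apply/measurable_EFinP; exact: mt.
- by move=> x _; rewrite lee_fin t0.
- by apply/measurable_EFinP; exact: mt.
- by move=> x _; rewrite lee_fin t0.
by rewrite !integral_tilt -EFinD -EFinM divff.
Qed.

Definition overlap (a b : R) : \bar R := (\int[N01]_x (tilt_ratio a b x)%:E)%E.

Lemma overlap_ge0 a b : (0 <= overlap a b)%E.
Proof. by apply: integral_ge0 => x _; rewrite lee_fin tilt_ratio_ge0. Qed.

Lemma overlapC a b : overlap a b = overlap b a.
Proof. by apply: eq_integral => x _; rewrite /tilt_ratio [tilt a x * _]mulrC. Qed.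

(** The two numerators add up to [2 * tilt a x * tilt_avg x], so the denominator cancels and
    [tilt a] has mean 1. *)
Lemma overlapD a : (overlap a mu + overlap a (- mu) = 2%:E)%E.
Proof.
have mt b := measurable_tilt_ratio a b.
rewrite -ge0_integralD//; first last.
- by apply/measurable_EFinP; exact: mt.
- by move=> x _; rewrite lee_fin tilt_ratio_ge0.
- by apply/measurable_EFinP; exact: mt.
- by move=> x _; rewrite lee_fin tilt_ratio_ge0.
transitivity (\int[N01]_x (2%:E * (tilt a x)%:E))%E.
  apply: eq_integral => x _; rewrite -EFinD -EFinM; congr EFin.
  rewrite /tilt_ratio -mulrDl -mulrDr /tilt_avg.
  by field; rewrite gt_eqF// addr_gt0// tilt_gt0.
rewrite ge0_integralZl//; first by rewrite integral_tilt mule1.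
- by apply/measurable_EFinP; exact: measurable_tilt.
- by move=> x _; rewrite lee_fin ltW// tilt_gt0.
Qed.

Lemma tilt_ratio_opp x : tilt_ratio mu (- mu) x = expR (- mu ^+ 2) / tilt_avg x.
Proof.
by rewrite /tilt_ratio /tilt -expRD; congr (expR _ / _); field.
Qed.

(** By the inequality between geometric and arithmetic means, the integrand is at most [tilt_avg x],
    which has mean 1. *)
Lemma overlap_opp_le1 : (overlap mu (- mu) <= 1)%E.
Proof.
rewrite -integral_tilt_avg; apply: ge0_le_integral => //.
- by move=> x _; rewrite lee_fin tilt_ratio_ge0.
- by apply/measurable_EFinP; exact: measurable_tilt_ratio.
- by apply/measurable_EFinP; exact: measurable_tilt_avg.
move=> x _; rewrite lee_fin /tilt_ratio ler_pdivrMr ?tilt_avg_gt0// /tilt_avg.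
rewrite -subr_ge0.
rewrite (_ : _ - _ = ((tilt mu x - tilt (- mu) x) / 2) ^+ 2) ?sqr_ge0//.
by field.
Qed.

(* [1 / y + y >= 2] with [y = tilt_avg x], which has mean 1 *)
Lemma overlap_opp_ge : ((expR (- mu ^+ 2))%:E <= overlap mu (- mu))%E.
Proof.
set e := expR _; have e0 : 0 < e by exact: expR_gt0.
have ma := measurable_tilt_avg.
have H : ((e + e)%:E <= overlap mu (- mu) + e%:E)%E.
  have -> : e%:E = (\int[N01]_x (e%:E * (tilt_avg x)%:E))%E.
    rewrite ge0_integralZl ?integral_tilt_avg ?mule1 ?lee_fin ?ltW//.
      exact/measurable_EFinP.
    by move=> x _; rewrite lee_fin ltW// tilt_avg_gt0.
  rewrite -ge0_integralD//; first last.
  - by apply: emeasurable_funM => //; exact/measurable_EFinP.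
  - by move=> x _; rewrite -EFinM lee_fin ltW// mulr_gt0// tilt_avg_gt0.
  - by apply/measurable_EFinP; exact: measurable_tilt_ratio.
  - by move=> x _; rewrite lee_fin tilt_ratio_ge0.
  have -> : (e + e)%:E = (\int[N01]_x (cst (e + e)%:E x))%E.
    rewrite (integral_cst N01 measurableT) [X in (_ * X)%E](@probability_setT _ _ _ N01).
    by rewrite mule1.
  apply: ge0_le_integral => //.
  - by move=> x _; rewrite lee_fin ltW// addr_gt0.
  - apply: emeasurable_funD; first by apply/measurable_EFinP; exact: measurable_tilt_ratio.
    by apply: emeasurable_funM => //; exact/measurable_EFinP.
  move=> x _; rewrite -EFinM -EFinD lee_fin tilt_ratio_opp -/e.
  have y0 := tilt_avg_gt0 x; move: (tilt_avg x) y0 => y y0.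
  rewrite -subr_ge0 (_ : _ - _ = e * (y - 1) ^+ 2 / y); last by field; rewrite gt_eqF.
  by rewrite divr_ge0 ?(ltW y0)// mulr_ge0 ?sqr_ge0// ltW.
by move: H; rewrite EFinD leeD2rE.
Qed.

(* [int tanh(mu x)^2 dx] under the balanced mixture of [N(-mu, 1)] and [N(mu, 1)] *)
Definition corr : R := 1 - fine (overlap mu (- mu)).

Lemma overlap_opp_fin : overlap mu (- mu) \is a fin_num.
Proof.
by rewrite ge0_fin_numE ?overlap_ge0// (le_lt_trans overlap_opp_le1)// ltry.
Qed.

Lemma corr_ge0 : 0 <= corr.
Proof.
by rewrite subr_ge0 -lee_fin fineK ?overlap_opp_fin// overlap_opp_le1.
Qed.

Lemma corr_le : corr <= 1 - expR (- mu ^+ 2).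
Proof.
by rewrite lerD2l lerN2 -lee_fin fineK ?overlap_opp_fin// overlap_opp_ge.
Qed.

(** For opposite signs this is the definition of [corr]; for equal signs [overlapD] gives 2 - (1 -
    [corr]). *)
Lemma overlap_signE (b c : bool) :
  overlap (if b then - mu else mu) (if c then - mu else mu) =
  (1 + corr * ((-1) ^+ b * (-1) ^+ c))%:E.
Proof.
have oE : overlap mu (- mu) = (1 - corr)%:E.
  by rewrite /corr subKr fineK// overlap_opp_fin.
have same (x : \bar R) : (x + (1 - corr)%:E = 2%:E -> x = (1 + corr)%:E)%E.
  by case: x => [x| |]//= [] xE; congr EFin; lra.
case: b; case: c => /=; rewrite ?expr0 ?expr1.
- rewrite mulrNN !mulr1; apply: same.
  by rewrite -oE addeC [overlap mu _]overlapC overlapD.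
- by rewrite mulr1 mulrN1 overlapC.
- by rewrite mul1r mulrN1.
- by rewrite !mulr1; apply: same; rewrite -oE overlapD.
Qed.

End overlap_integral.

Lemma size_cube_seq (R : realType) n (mu : R) : size (cube_seq n mu) = (2 ^ n)%N.
Proof.
by rewrite size_map -cardE -cardsT -finset.powersetT card_powerset cardsT card_ord.
Qed.

Lemma size_balanced_seq (R : realType) n (mu : R) :
  size (balanced_seq n mu) = 'C(n, n./2).
Proof.
rewrite size_map size_filter -sum1_count big_enum_cond /= sum1_card -cardsE.
by rewrite card_draws card_ord.
Qed.

(** * The second moment of the likelihood ratio *)

Section second_moment.
Variables (R : realType) (m : nat) (mu : R).
Hypothesis mu0 : 0 < mu.
Let n := m.*2.
Local Notation G := (std_gaussian R n).
Local Notation t := (corr mu).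
Local Notation N := ('C(n, m)%:R : R).

(** The coordinates are independent under Q: expanding the product of averages selects the set A of
    coordinates with mean - mu. *)
Lemma mixture_cubeE (x : n.-tuple R) :
  mixture (cube_seq n mu) x = \prod_i tilt_avg mu (tnth x i).
Proof.
rewrite /mixture size_cube_seq big_map big_enum /=.
rewrite /tilt_avg big_split /= prodr_const card_ord exprVn mulrC natrX; congr (_ / _).
under [RHS]eq_bigr do rewrite addrC.
rewrite bigA_distr; apply: eq_bigr => A _; apply: eq_bigr => i _.
by rewrite tnth_mktuple; case: ifP.
Qed.

Lemma mixture_balancedE (x : n.-tuple R) :
  mixture (balanced_seq n mu) x =
  N^-1 * \sum_(A : {set 'I_n} | #|A| == m) tilts (signs mu A) x.
Proof.
by rewrite /mixture size_balanced_seq big_map big_filter big_enum_cond /= doubleK.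
Qed.

(** The denominator is a product over coordinates, so each pair (A, B) in the expanded square gives
    a product integrand, whose integral is a product of one-coordinate overlaps. *)
Lemma ge0_integral_mixture_sqr :
  (\int[G]_x (mixture (balanced_seq n mu) x ^+ 2 / mixture (cube_seq n mu) x)%:E =
   (N ^- 2 * \sum_(A : {set 'I_n} | #|A| == m) \sum_(B : {set 'I_n} | #|B| == m)
      \prod_i (1 + t * (set_sign R A i * set_sign R B i)))%:E)%E.
Proof.
pose ratio (A B : {set 'I_n}) (x : n.-tuple R) : R :=
  \prod_i tilt_ratio mu (tnth (signs mu A) i) (tnth (signs mu B) i) (tnth x i).
have mratio A B : measurable_fun setT (ratio A B).
  apply: (@measurable_prod_tnth R n (fun i =>
    tilt_ratio mu (tnth (signs mu A) i) (tnth (signs mu B) i))) => i.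
  exact: measurable_tilt_ratio.
have ratio0 A B x : 0 <= ratio A B x.
  by apply: prodr_ge0 => i _; exact: tilt_ratio_ge0.
transitivity (\int[G]_x ((N ^- 2)%:E * \sum_(A : {set 'I_n} | #|A| == m)
   \sum_(B : {set 'I_n} | #|B| == m) (ratio A B x)%:E))%E.
  apply: eq_integral => x _; under [in RHS]eq_bigr do rewrite sumEFin.
  rewrite sumEFin -EFinM mixture_cubeE mixture_balancedE exprMn exprVn -mulrA; congr (_ * _)%:E.
  rewrite expr2 mulr_suml mulr_suml; apply: eq_bigr => A _.
  rewrite mulr_sumr mulr_suml; apply: eq_bigr => B _.
  by rewrite /ratio [RHS]big_split /= prodfV; congr (_ / _); rewrite big_split.
rewrite ge0_integralZl//; first last.
- by move=> x _; rewrite sume_ge0// => A _; rewrite sume_ge0// => B _; rewrite lee_fin.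
- by do 2 (apply: emeasurable_sum_cond => ?); exact/measurable_EFinP.
rewrite EFinM; congr (_ * _)%E.
have mratioE A B : measurable_fun setT (EFin \o ratio A B) by exact/measurable_EFinP.
rewrite ge0_integral_sum_cond; first last.
- by move=> A x; rewrite sume_ge0// => B _; rewrite lee_fin.
- by move=> A; apply: emeasurable_sum_cond => B; exact: mratioE.
rewrite -sumEFin; apply: eq_bigr => A _.
rewrite ge0_integral_sum_cond; first last.
- by move=> B x; rewrite lee_fin.
- by move=> B; exact: mratioE.
rewrite -sumEFin; apply: eq_bigr => B _.
rewrite (@ge0_integral_std_gaussian_prod R n
  (fun i => tilt_ratio mu (tnth (signs mu A) i) (tnth (signs mu B) i))).
- by rewrite -prodEFin; apply: eq_bigr => i _; rewrite !tnth_mktuple -overlap_signE.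
- by move=> i; exact: measurable_tilt_ratio.
- by move=> i x; exact: tilt_ratio_ge0.
Qed.

Lemma chi2_le : (chi2 (P_law n mu) (Q_law n mu) <= (t ^+ 2 / (1 - t))%:E)%E.
Proof.
have N0 : (0 < N) by rewrite ltr0n bin_gt0 /n; lia.
have t1 : t < 1.
  by rewrite (le_lt_trans (corr_le mu))// ltrBlDr ltrDl expR_gt0.
have sc : (0 < size (cube_seq n mu))%N.
  by rewrite size_cube_seq expn_gt0.
have sb : (0 < size (balanced_seq n mu))%N.
  by rewrite size_balanced_seq bin_gt0 doubleK /n; lia.
have n2 : ~~ odd n by rewrite odd_double.
have := @chi2_densityE _ _ R (P_law n mu) (Q_law n mu) G
  (mixture (balanced_seq n mu)) (mixture (cube_seq n mu))
  (measurable_mixture _) (measurable_mixture _) (mixture_ge0 _)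
  (fun x => mixture_gt0 x sc)
  (fun f => ge0_integral_signal_plus_noise _ _
     (@uniq_balanced_seq R n mu mu0) sb (@balanced_seqE R n mu mu0 n2))
  (fun f => ge0_integral_signal_plus_noise _ _
     (@uniq_cube_seq R n mu mu0) sc (@cube_seqE R n mu mu0)).
rewrite ge0_integral_mixture_sqr.
have := sum_overlap_le m (corr_ge0 mu) t1.
set S := \sum_(A | _) _ => Sle.
(* The other side of the identity is finite, which excludes infinite values of the divergence. *)
case: (chi2 _ _) => [r| |]//= [] rE; rewrite lee_fin.
have : N ^- 2 * S <= 1 + t ^+ 2 / (1 - t).
  by rewrite ler_pdivrMl ?exprn_gt0.
lra.
Qed.

End second_moment.

(** * The bounds for small and large mu *)

Theorem mainTheorem5 (R : realType) :
  exists C : R, forall (n : nat) (mu : R),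
    (0 < n)%N -> ~~ odd n -> 0 < mu ->
    (mu <= 1 -> (chi2 (P_law n mu) (Q_law n mu) <= (C * mu ^+ 4)%:E)%E) /\
    (1 < mu -> (chi2 (P_law n mu) (Q_law n mu) <= (C * expR (mu ^+ 2))%:E)%E).
Proof.
(* The constant bounds exp(mu^2) when mu <= 1, and it is at least 1, which suffices when mu > 1. *)
exists (expR 1) => n mu _ n2 mu0.
rewrite -(even_halfK n2); have := chi2_le n./2 mu0.
have t0 := corr_ge0 mu; have tle := corr_le mu.
set t := corr mu in t0 tle *; set e := expR (mu ^+ 2).
have e0 : 0 < e by exact: expR_gt0.
have eN : expR (- mu ^+ 2) = e^-1 by rewrite expRN.
rewrite eN in tle.
have e1 : 1 <= expR 1 :> R by rewrite -expR0 ler_expR.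
(* Here [e] is exp(mu^2), and [corr_le] says that 1 - t is at least its inverse. *)
have chi_e : t ^+ 2 / (1 - t) <= t ^+ 2 * e.
  rewrite ler_wpM2l ?sqr_ge0// -[e]invrK lef_pV2 ?posrE ?invr_gt0//.
    by rewrite lerBrDr addrC -lerBrDr.
  by rewrite (lt_le_trans (_ : 0 < e^-1)) ?invr_gt0// lerBrDr addrC -lerBrDr.
move=> chi; split=> mu1; apply: (le_trans chi); rewrite lee_fin (le_trans chi_e)//.
(* From t <= 1 - exp(- mu^2) and 1 + x <= exp(x) at x = - mu^2. *)
- have tmu : t <= mu ^+ 2.
    have := expR_ge1Dx (- mu ^+ 2); rewrite eN; lra.
  rewrite mulrC ler_pM ?sqr_ge0 ?(ltW e0)//.
    by rewrite /e ler_expR expr_le1// ltW.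
  by rewrite (_ : mu ^+ 4 = (mu ^+ 2) ^+ 2) ?lerXn2r ?nnegrE ?sqr_ge0// -exprM.
- rewrite ler_wpM2r ?(ltW e0)// (le_trans _ e1)// expr_le1//.
  by rewrite (le_trans tle)// gerBl invr_ge0 ltW.
Qed.
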